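(* For every $n\ge 0$, the number of $h$-avoiding GNC-trees with $n+1$ vertices is $$|\mathsf{GNC}_n(h)|=\sum_{i=0}^n(-1)^{n-i}\frac{2^i}{2i+1}\binom{3i}{i}\binom{n+2i}{3i}.$$
   Context: A non-crossing tree on $n+1$ points: place $n+1$ points $p_0,\dots,p_n$ on a circle in counterclockwise order and draw a tree on them with straight edges inside the circle, no two crossing. A (rooted) GNC-tree with $n+1$ vertices is such a tree with a labelling of the points by positive integers, weakly increasing along $p_0,\dots,p_n$, $p_0$ labelled 1, label set $\{1,\dots,m\}$ for some $m$; rooted at $p_0$. $\mathsf{GNC}_n$ is the set of these. Orient each edge from parent (closer to root) to child; it is an ascent ($u$) if parent label $<$ child label, a level ($h$) if equal, a descent ($d$) if larger. Each root-to-vertex path gives a word over $\{u,h,d\}$. A tree contains a word $\sigma$ if some root-to-vertex path word contains $\sigma$ as a contiguous factor, and is $\sigma$-avoiding otherwise; $\mathsf{GNC}_n(P)$ is the set of trees in $\mathsf{GNC}_n$ avoiding every word in $P$. Thus $\mathsf{GNC}_n(h)$ is the set of trees with no level edge. *)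

(* Defs.v *)
From HB Require Import structures.
From mathcomp Require Import all_boot all_order all_algebra.
From mathcomp Require Import boolp.

Set Implicit Arguments.
Unset Strict Implicit.
Unset Printing Implicit Defensive.

(* The point p_i is represented by the ordinal i : 'I_n.+1. *)

Section Graphs.
Variable n : nat.
Implicit Type E : {set 'I_n.+1 * 'I_n.+1}.

(* An undirected edge {x, y} is stored as both pairs (x, y) and (y, x). *)
Definition adj E : rel 'I_n.+1 := fun x y => (x, y) \in E.

Definition simple_graph E : Prop := symmetric (adj E) /\ irreflexive (adj E).

Definition connected E : Prop := forall x y, connect (adj E) x y.

(* [ucycle] also accepts x, y, x (a single edge), which is not a cycle of the
   graph: hence the bound on the size. *)
Definition acyclic E : Prop :=
  forall c : seq 'I_n.+1, 2 < size c -> ~ ucycle (adj E) c.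

Definition tree E : Prop := [/\ simple_graph E, connected E & acyclic E].

(* For points placed on a circle in the order of their indices, two chords
   meet inside the circle iff their endpoints strictly interleave. *)
Definition non_crossing E : Prop :=
  forall a b c d : 'I_n.+1, a < c -> c < b -> b < d -> ~ (adj E a b /\ adj E c d).

Definition gnc_labelling (l : 'I_n.+1 -> nat) : Prop :=
  [/\ forall i j : 'I_n.+1, i <= j -> l i <= l j,
      l ord0 = 1 &
      exists m, forall k, (exists i, l i = k) <-> 1 <= k <= m].

Lemma gnc_labelling_bound l :
  gnc_labelling l -> forall i, l i < n.+2.
Proof.
case=> _ _ [m Hm] i.
have /andP[_ lim] : 1 <= l i <= m by apply/Hm; exists i.
rewrite ltnS; apply: (leq_trans lim).
have : size (iota 1 m) <= size (codom l).
  apply: uniq_leq_size (iota_uniq 1 m) _ => k.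
  rewrite mem_iota add1n ltnS => /Hm[j <-]; exact: codom_f.
by rewrite size_iota size_codom card_ord.
Qed.

End Graphs.

Inductive letter := Ascent | Level | Descent.

Definition letter_eq_dec (x y : letter) : {x = y} + {x <> y}.
Proof. decide equality. Defined.

HB.instance Definition _ := hasDecEq.Build letter (compareP letter_eq_dec).

Definition edge_letter (parent child : nat) : letter :=
  if parent < child then Ascent
  else if parent == child then Level else Descent.

Section Words.
Variable n : nat.
Implicit Types (E : {set 'I_n.+1 * 'I_n.+1}) (l : 'I_n.+1 -> nat).

(* [ord0 :: p] is the path from the root p_0 to [last ord0 p]. In a tree, two
   consecutive vertices of such a simple path are a parent and its child. *)
Definition root_path E (p : seq 'I_n.+1) : Prop :=
  path (adj E) ord0 p /\ uniq (ord0 :: p).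

Definition path_word l (p : seq 'I_n.+1) : seq letter :=
  pairmap (fun x y => edge_letter (l x) (l y)) ord0 p.

Definition contains E l (s : seq letter) : Prop :=
  exists2 p, root_path E p & infix s (path_word l p).

Definition avoids_all E l (P : {pred seq letter}) : Prop :=
  forall s, s \in P -> ~ contains E l s.

End Words.

(* Labels live in 'I_n.+2 so that the type is finite; by [gnc_labelling_bound]
   no labelling by positive integers is lost. *)
Notation labelled_graph n :=
  ({set 'I_n.+1 * 'I_n.+1} * {ffun 'I_n.+1 -> 'I_n.+2})%type.

Definition label n (T : labelled_graph n) (i : 'I_n.+1) : nat := T.2 i.

Definition GNC (n : nat) : {set labelled_graph n} :=
  [set T : labelled_graph n |
    `[< [/\ tree T.1, non_crossing T.1 & gnc_labelling (label T)] >]].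

Definition GNC_avoiding (n : nat) (P : {pred seq letter}) :
    {set labelled_graph n} :=
  [set T in GNC n | `[< avoids_all T.1 (label T) P >]].

(* Main.v *)
(* Encode a weakly increasing labelling by the set of points where the label
   goes up. Let [p_k] be the largest neighbour of the root. The part of the tree
   on [p_k, ..., p_n] is an arbitrary h-avoiding tree, and deleting the edge
   [p_0 p_k] splits the part on [p_0, ..., p_k] into trees on [p_0, ..., p_j] and
   [p_(j+1), ..., p_k], the label step between [p_j] and [p_(j+1)] being free.
   The only forbidden outcome is that [p_0 p_k] is level, which forces [k = 1]
   and a zero step. Hence the generating function satisfies
   [G = 1 + 2 x G^3 - x G], and the powers of [G] satisfy
   [(1 + x) G^(r+1) = G^r + 2 x G^(r+3)], a recurrence which determines all
   their coefficients and which the closed form also satisfies. *)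
Require Import Defs.
From mathcomp Require Import all_boot all_order all_algebra.
From mathcomp Require Import boolp zify ring.

Set Implicit Arguments.
Unset Strict Implicit.
Unset Printing Implicit Defensive.

(** * Bridges *)

Section Connect.
Variable V : finType.
Implicit Types e : rel V.

Lemma connect_inv e (P : V -> Prop) x y :
  (forall u v, P u -> e u v -> P v) -> connect e x y -> P x -> P y.
Proof.
move=> eP /connectP[p]; elim: p x => [|z p IHp] x /=; first by move=> _ ->.
by case/andP=> xz zp yE Px; apply: (IHp z) => //; apply: eP xz.
Qed.

(** Applied below to retractions [f] that collapse one piece of a glued graph to a point: edges of
    that piece become trivial, and a path in the whole graph projects to a path in the other
    piece. *)
Lemma connect_map e e' (f : V -> V) x y :
  (forall u v, e u v -> connect e' (f u) (f v)) ->
  connect e x y -> connect e' (f x) (f y).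
Proof.
move=> ef xy; apply: (connect_inv (P := fun z => connect e' (f x) (f z))) xy _.
  by move=> u v xu uv; apply: connect_trans (ef _ _ uv).
exact: connect0.
Qed.

Lemma connect_mono e e' x y :
  (forall u v, e u v -> e' u v) -> connect e x y -> connect e' x y.
Proof. by move=> ee'; apply: connect_sub => u v /ee'/connect1. Qed.

Definition cut_edge e x y : rel V :=
  fun u v => [&& e u v, (u, v) != (x, y) & (u, v) != (y, x)].

Lemma cut_sub e x y u v : cut_edge e x y u v -> e u v.
Proof. by case/and3P. Qed.

Lemma cut_sym e x y : symmetric e -> symmetric (cut_edge e x y).
Proof.
move=> es u v; rewrite /cut_edge es !xpair_eqE [X in _ && X]andbC.
by rewrite (andbC (u == y)) (andbC (u == x)).
Qed.

(** Acyclicity in terms of connectivity alone. Unlike a statement about cycles, it can be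
    transported along [connect_map] and [connect_mono]. *)
Definition bridges e := forall x y, e x y -> ~ connect (cut_edge e x y) x y.

(** A detour around an edge [x y], once shortened to a simple path, closes up with that edge to a
    cycle; conversely, a cycle minus its first edge is a detour around it. *)
Lemma acyclic_bridges e : symmetric e -> irreflexive e ->
  (forall c : seq V, 2 < size c -> ~ ucycle e c) <-> bridges e.
Proof.
move=> es ei; split=> [acyc x y xy | br [|x [|y [|z p]]] // _].
  case/connectP=> p xp yE; case/shortenP: xp yE => q xq uq _ yE.
  apply: (acyc (x :: q)); last first.
    apply/andP; split=> //; rewrite /= rcons_path -yE es xy andbT.
    by apply: sub_path xq => u v /cut_sub.
  (* The cycle has more than two vertices: an empty [q] would make [x y] a loop, and a one-vertex
     [q] would use the deleted edge. *)
  case: q xq uq yE => [|z [|w q]] //=; first by move=> _ _ yE; rewrite yE ei in xy.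
  by move=> + _ yE; rewrite -yE => /andP[/and3P[_ /eqP]].
case/andP=> /= /and3P[xy yz]; rewrite rcons_path => /andP[zp lx].
case/and3P=> x_yzp y_zp uzp; apply: (br x y) => //.
rewrite (sym_connect_sym (cut_sym _ _ es)).
have ylast : last z p != y by apply: contraNneq y_zp => <-; apply: mem_last.
apply: (@connect_trans _ _ (last z p)); last first.
  apply: connect1; rewrite /cut_edge lx !xpair_eqE (negPf ylast) /= andbT.
  by apply: contraNN x_yzp => /andP[_ /eqP->]; rewrite inE eqxx.
(* A path that never visits [x] cannot use the deleted edge. *)
have cut_path q v :
    path e v q -> all (predC1 x) (v :: q) -> path (cut_edge e x y) v q.
  elim: q v => //= w q IHq v /andP[vw wq] /and3P[vx wx qx].
  rewrite IHq ?wx // andbT /cut_edge vw !xpair_eqE.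
  by rewrite (negPf vx) (negPf wx) /= andbF.
apply/connectP; exists (z :: p); last by [].
apply: cut_path; first by rewrite /= yz.
by apply/allP => w wp /=; apply: contraNneq x_yzp => <-.
Qed.
End Connect.

(** * Gluing and splitting non-crossing trees *)

Section Trees.
Variable N : nat.
Notation V := 'I_N.+1.
Implicit Types (E : {set V * V}) (a b : nat) (x y u v : V).

(** Trees on all intervals live in one ambient type of points, so that gluing is plain union and
    needs no renumbering. The bounds are natural numbers, which lets an interval start at [j.+1]. *)
Record nctree a b E : Prop := NCTree {
  nc_sym : symmetric (adj E);
  nc_irr : irreflexive (adj E);
  nc_in : forall x y, adj E x y -> [/\ a <= x, x <= b, a <= y & y <= b];
  nc_conn : forall x y, a <= x <= b -> a <= y <= b -> connect (adj E) x y;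
  nc_bridge : bridges (adj E);
  nc_cross : non_crossing E }.

Lemma tree_nctree E : tree E /\ non_crossing E <-> nctree 0 N E.
Proof.
split=> [[[[es ei] ec ea] ex] | [es ei _ ec eb ex]].
  split=> //; first by move=> x y _; split=> //; exact: leq_ord.
  exact/acyclic_bridges.
split=> //; split=> //; last exact/acyclic_bridges.
by move=> x y; apply: ec; exact: leq_ord.
Qed.

Definition restr a b E : {set V * V} :=
  [set p in E | (a <= p.1 <= b) && (a <= p.2 <= b)].

Lemma adj_restr a b E x y :
  adj (restr a b E) x y = adj E x y && ((a <= x <= b) && (a <= y <= b)).
Proof. by rewrite /adj inE. Qed.

Lemma adjU E1 E2 x y : adj (E1 :|: E2) x y = adj E1 x y || adj E2 x y.
Proof. by rewrite /adj inE. Qed.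

Definition edge x y : {set V * V} :=
  [set p | (p == (x, y)) || (p == (y, x))].

Lemma adj_edge x y u v :
  adj (edge x y) u v = (u == x) && (v == y) || (u == y) && (v == x).
Proof. by rewrite /adj !inE !xpair_eqE. Qed.

Lemma nctree1 (k : V) E : nctree k k E <-> E = set0.
Proof.
split=> [[_ ei ein _ _ _] | ->].
  apply/setP=> -[x y]; rewrite inE; apply/negP => xy.
  have [h1 h2 h3 h4] := ein _ _ xy.
  have xyE : x = y by apply/val_inj => /=; lia.
  by move: (ei x); rewrite /adj {2}xyE xy.
have e0 x y : adj set0 x y = false by rewrite /adj inE.
split=> [x y|x|x y|x y hx hy|x y|x y u v _ _ _ []]; rewrite ?e0 //.
by have -> : x = y by [apply/val_inj => /=; lia].
Qed.

Lemma restr_sub_bridges a b E : bridges (adj E) -> bridges (adj (restr a b E)).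
Proof.
move=> br x y; rewrite adj_restr => /andP[xy _] c; apply: (br x y) => //.
apply: connect_mono c => u v; rewrite /cut_edge adj_restr.
by case/and3P=> /andP[-> _] -> ->.
Qed.

(** Symmetry, absence of loops, bridges and non-crossing all pass to subgraphs; only connectivity
    has to be supplied. *)
Lemma nctree_restr a b E c d : nctree c d E ->
  (forall x y, a <= x <= b -> a <= y <= b -> connect (adj (restr a b E)) x y) ->
  nctree a b (restr a b E).
Proof.
case=> es ei ein ec eb ex ec'; split=> //.
- by move=> x y; rewrite !adj_restr es andbC [in RHS]andbC; congr andb; rewrite andbC.
- by move=> x; rewrite adj_restr ei.
- by move=> x y; rewrite adj_restr => /and3P[_ /andP[-> ->] /andP[-> ->]].
- exact: restr_sub_bridges.
- move=> x y u v xu uy yv [/[!adj_restr]/andP[xy _] /andP[uv _]].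
  exact: (ex x y u v).
Qed.

(** * Two trees sharing the vertex [k] *)

Section Wedge.
Variables (a b : nat) (k : V).
Hypotheses (ak : a <= k) (kb : k <= b).

Lemma wedge E1 E2 : nctree a k E1 -> nctree k b E2 -> nctree a b (E1 :|: E2).
Proof.
case=> es1 ei1 ein1 ec1 eb1 ex1 [es2 ei2 ein2 ec2 eb2 ex2].
have sub1 x y : connect (adj E1) x y -> connect (adj (E1 :|: E2)) x y.
  by apply: connect_mono => u v; rewrite adjU => ->.
have sub2 x y : connect (adj E2) x y -> connect (adj (E1 :|: E2)) x y.
  by apply: connect_mono => u v; rewrite adjU orbC => ->.
have es : symmetric (adj (E1 :|: E2)) by move=> x y; rewrite !adjU es1 es2.
have tok x : a <= x <= b -> connect (adj (E1 :|: E2)) x k.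
  move=> hx; case: (leqP x k) => xk; first by apply/sub1/ec1; lia.
  by apply/sub2/ec2; lia.
split=> //.
- by move=> x; rewrite adjU ei1 ei2.
- move=> x y; rewrite adjU => /orP[/ein1|/ein2] [*]; split; lia.
- move=> x y hx hy; apply: connect_trans (tok x hx) _.
  by rewrite sym_connect_sym // tok.
- move=> x y; rewrite adjU => /orP[] xy c.
    apply: (eb1 x y) => //; have [h1 h2 h3 h4] := ein1 _ _ xy.
    (* The retraction onto the left interval collapses [E2] to the point [k] and fixes [E1], so a
       detour around an edge of [E1] in the union projects to one inside [E1]. The other case is its
       mirror image. *)
    pose r (z : V) := if z <= k then z else k.
    have rle (z : V) : z <= k -> r z = z by rewrite /r => ->.
    have rge (z : V) : k <= z -> r z = k.
      by rewrite /r; case: ifP => // zk kz; apply/val_inj/eqP; rewrite eqn_leq zk.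
    suff: connect (cut_edge (adj E1) x y) (r x) (r y) by rewrite !rle.
    apply: connect_map c => u v.
    rewrite /cut_edge adjU => /and3P[/orP[] uv uv1 uv2].
      have [g1 g2 g3 g4] := ein1 _ _ uv.
      by rewrite !rle //; apply: connect1; rewrite uv uv1.
    by have [g1 g2 g3 g4] := ein2 _ _ uv; rewrite !rge ?connect0.
  apply: (eb2 x y) => //; have [h1 h2 h3 h4] := ein2 _ _ xy.
  pose r (z : V) := if k <= z then z else k.
  have rge (z : V) : k <= z -> r z = z by rewrite /r => ->.
  have rle (z : V) : z <= k -> r z = k.
    by rewrite /r; case: ifP => // zk kz; apply/val_inj/eqP; rewrite eqn_leq kz.
  suff: connect (cut_edge (adj E2) x y) (r x) (r y) by rewrite !rge.
  apply: connect_map c => u v.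
  rewrite /cut_edge adjU => /and3P[/orP[] uv uv1 uv2].
    by have [g1 g2 g3 g4] := ein1 _ _ uv; rewrite !rle ?connect0.
  have [g1 g2 g3 g4] := ein2 _ _ uv.
  by rewrite !rge //; apply: connect1; rewrite uv uv1.
- move=> x y u v xu uy yv []; rewrite !adjU => /orP[] xy /orP[] uv.
  + exact: (ex1 x y u v).
  + by have [] := ein1 _ _ xy; have [] := ein2 _ _ uv; lia.
  + by have [] := ein2 _ _ xy; have [] := ein1 _ _ uv; lia.
  + exact: (ex2 x y u v).
Qed.

(** The intervals meet only in [k], so an edge of [E2] lying inside [[a, k]] would be a loop. *)
Lemma wedge_restrl E1 E2 : nctree a k E1 -> nctree k b E2 ->
  restr a k (E1 :|: E2) = E1.
Proof.
case=> es1 ei1 ein1 ec1 eb1 ex1 [es2 ei2 ein2 ec2 eb2 ex2].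
apply/setP=> -[x y]; rewrite !inE /=; apply/idP/idP.
  case/andP=> /orP[//|xy] h; have [h1 h2 h3 h4] := ein2 _ _ xy.
  have xyE : x = y by apply/val_inj => /=; lia.
  by move: (ei2 x); rewrite /adj {2}xyE xy.
by move=> xy; have [h1 h2 h3 h4] := ein1 _ _ xy; rewrite xy /=; lia.
Qed.

Lemma wedge_restrr E1 E2 : nctree a k E1 -> nctree k b E2 ->
  restr k b (E1 :|: E2) = E2.
Proof.
case=> es1 ei1 ein1 ec1 eb1 ex1 [es2 ei2 ein2 ec2 eb2 ex2].
apply/setP=> -[x y]; rewrite !inE /=; apply/idP/idP.
  case/andP=> /orP[xy|//] h; have [h1 h2 h3 h4] := ein1 _ _ xy.
  have xyE : x = y by apply/val_inj => /=; lia.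
  by move: (ei1 x); rewrite /adj {2}xyE xy.
by move=> xy; have [h1 h2 h3 h4] := ein2 _ _ xy; rewrite xy orbT /=; lia.
Qed.

(** Since no edge passes over [k], each edge stays on one side of it, and collapsing the other side
    to [k] turns paths of [E] into paths of the restriction. *)
Lemma unwedge E : nctree a b E -> (forall x y, adj E x y -> ~ (x < k < y)) ->
  [/\ nctree a k (restr a k E), nctree k b (restr k b E) &
      restr a k E :|: restr k b E = E].
Proof.
move=> T nok; case: (T) => es ei ein ec eb ex.
have nok' (x y : V) : adj E x y -> x <= k /\ y <= k \/ k <= x /\ k <= y.
  by move=> xy; have := nok _ _ xy; rewrite es in xy; have := nok _ _ xy; lia.
split.
- apply: nctree_restr T _ => x y hx hy.
  pose r (z : V) := if z <= k then z else k.
  have rle (z : V) : z <= k -> r z = z by rewrite /r => ->.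
  have rge (z : V) : k <= z -> r z = k.
    by rewrite /r; case: ifP => // zk kz; apply/val_inj/eqP; rewrite eqn_leq zk.
  have : connect (adj E) x y by apply: ec; lia.
  move=> c; suff: connect (adj (restr a k E)) (r x) (r y) by rewrite !rle //; lia.
  apply: connect_map c => u v uv.
  have [h1 h2 h3 h4] := ein _ _ uv.
  case: (nok' _ _ uv) => -[uk vk]; last by rewrite !rge ?connect0.
  by rewrite !rle //; apply: connect1; rewrite adj_restr uv /=; lia.
- apply: nctree_restr T _ => x y hx hy.
  pose r (z : V) := if k <= z then z else k.
  have rge (z : V) : k <= z -> r z = z by rewrite /r => ->.
  have rle (z : V) : z <= k -> r z = k.
    by rewrite /r; case: ifP => // zk kz; apply/val_inj/eqP; rewrite eqn_leq kz.
  have : connect (adj E) x y by apply: ec; lia.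
  move=> c; suff: connect (adj (restr k b E)) (r x) (r y) by rewrite !rge //; lia.
  apply: connect_map c => u v uv.
  have [h1 h2 h3 h4] := ein _ _ uv.
  case: (nok' _ _ uv) => -[uk vk]; first by rewrite !rle ?connect0.
  by rewrite !rge //; apply: connect1; rewrite adj_restr uv /=; lia.
- apply/setP=> -[x y]; rewrite !inE /=; apply/idP/idP.
    by case/orP=> /andP[].
  move=> xy; have [h1 h2 h3 h4] := ein _ _ xy; rewrite xy /=.
  by case: (nok' _ _ xy); lia.
Qed.

End Wedge.

(** * Two trees on adjacent intervals, linked by the edge between their outer ends *)

Section Join.
Variables (a k j j' : V).
Hypotheses (aj : a <= j) (jj : j' = j.+1 :> nat) (jk : j < k).

Let akN : (a == k) = false.
Proof. by apply/negP => /eqP E; have := aj; rewrite E; lia. Qed.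

Lemma join E1 E2 : nctree a j E1 -> nctree j' k E2 ->
  nctree a k (E1 :|: E2 :|: edge a k).
Proof.
case=> es1 ei1 ein1 ec1 eb1 ex1 [es2 ei2 ein2 ec2 eb2 ex2].
set E := _ :|: edge a k.
have adjE x y : adj E x y = [|| adj E1 x y, adj E2 x y | adj (edge a k) x y].
  by rewrite /E adjU adjU orbA.
have es : symmetric (adj E).
  move=> x y; rewrite !adjE es1 es2 !adj_edge !(andbC (y == _)).
  by rewrite [(_ && (y == a)) || _]orbC.
have sub1 x y : connect (adj E1) x y -> connect (adj E) x y.
  by apply: connect_mono => u v; rewrite adjE => ->.
have sub2 x y : connect (adj E2) x y -> connect (adj E) x y.
  by apply: connect_mono => u v; rewrite adjE => ->; rewrite orbT.
have cak : connect (adj E) a k.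
  by apply: connect1; rewrite adjE adj_edge !eqxx !orbT.
have toa x : a <= x <= k -> connect (adj E) x a.
  move=> hx; case: (leqP x j) => xj; first by apply/sub1/ec1; lia.
  rewrite sym_connect_sym //; apply: connect_trans cak _.
  by apply/sub2/ec2; lia.
have adjE3 x y : adj (edge a k) x y -> x = a /\ y = k \/ x = k /\ y = a.
  by rewrite adj_edge => /orP[]/andP[/eqP-> /eqP->]; [left | right].
(* [r a] collapses the right block to [a], and [r' k] collapses the left block to [k]; either way
   the new edge [a k] becomes a point. *)
pose r c (z : V) := if z <= j then z else c.
pose r' c (z : V) := if z <= j then c else z.
have rlt c (z : V) : z <= j -> (r c z = z) * (r' c z = c) by rewrite /r /r' => ->.
have rgt c (z : V) : j < z -> (r c z = c) * (r' c z = z) by rewrite ltnNge /r /r' => /negPf->.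
split=> //.
- move=> x; rewrite adjE ei1 ei2 adj_edge andbC orbb andbC.
  by case: eqP => // ->; rewrite akN.
- move=> x y; rewrite adjE => /or3P[/ein1[*]|/ein2[*]|/adjE3[] [-> ->]]; split; lia.
- move=> x y hx hy; apply: connect_trans (toa x hx) _.
  by rewrite sym_connect_sym // toa.
- move=> x y; rewrite adjE => /or3P[] xy c.
  + apply: (eb1 x y) => //; have [h1 h2 h3 h4] := ein1 _ _ xy.
    suff: connect (cut_edge (adj E1) x y) (r a x) (r a y) by rewrite !rlt.
    apply: connect_map c => u v.
    rewrite /cut_edge adjE => /and3P[/or3P[uv|uv|/adjE3[] [-> ->]] uv1 uv2].
    * have [g1 g2 g3 g4] := ein1 _ _ uv.
      by rewrite !rlt //; apply: connect1; rewrite uv uv1.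
    * by have [g1 g2 g3 g4] := ein2 _ _ uv; rewrite !rgt ?connect0 //; lia.
    * by rewrite rlt // rgt ?connect0.
    * by rewrite (rlt _ a) // rgt ?connect0.
  + apply: (eb2 x y) => //; have [h1 h2 h3 h4] := ein2 _ _ xy.
    suff: connect (cut_edge (adj E2) x y) (r' k x) (r' k y) by rewrite !rgt //; lia.
    apply: connect_map c => u v.
    rewrite /cut_edge adjE => /and3P[/or3P[uv|uv|/adjE3[] [-> ->]] uv1 uv2].
    * by have [g1 g2 g3 g4] := ein1 _ _ uv; rewrite !rlt ?connect0 //; lia.
    * have [g1 g2 g3 g4] := ein2 _ _ uv.
      by rewrite !rgt //; [apply: connect1; rewrite uv uv1 | lia | lia].
    * by rewrite rlt // rgt ?connect0.
    * by rewrite (rlt _ a) // rgt ?connect0.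
  (* The new edge is the only one between the two blocks: without it, the side of [j] is invariant
     along paths. *)
  + have inv : forall u v, cut_edge (adj E) x y u v -> (u <= j) = (v <= j).
      move=> u v; rewrite /cut_edge adjE => /and3P[/or3P[uv|uv|/adjE3 uv] uv1 uv2].
      * by have [g1 g2 g3 g4] := ein1 _ _ uv; rewrite g2 g4.
      * have [g1 g2 g3 g4] := ein2 _ _ uv; lia.
      * by case/adjE3: xy uv uv1 uv2 => -[-> ->] [] [-> ->]; rewrite ?eqxx.
    have : (x <= j) = (y <= j).
      apply: (connect_inv (P := fun z : V => (x <= j) = (z <= j))) c _ => //.
      by move=> u v -> /inv.
    by case/adjE3: xy => -[-> ->]; lia.
- move=> x y u v xu uy yv []; rewrite !adjE.
  have cases z w : [|| adj E1 z w, adj E2 z w | adj (edge a k) z w] ->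
     adj E1 z w \/ adj E2 z w \/ (z = a /\ w = k \/ z = k /\ w = a).
    by case/or3P=> [h|h|/adjE3]; auto.
  have bd z w : [|| adj E1 z w, adj E2 z w | adj (edge a k) z w] ->
     [/\ a <= z, z <= k, a <= w & w <= k].
    by move=> /or3P[/ein1[*]|/ein2[*]|/adjE3[] [-> ->]]; split; lia.
  move=> /[dup] /bd[g1 g2 g3 g4] /cases cxy /[dup] /bd[f1 f2 f3 f4] /cases cuv.
  case: cxy => [xy|[xy|[] [xE yE]]]; try by rewrite xE yE in xu yv; lia.
  + case: cuv => [uv|[uv|[] [uE vE]]]; try by rewrite uE vE in xu uy yv; lia.
      exact: (ex1 x y u v).
    by have [] := ein1 _ _ xy; have [] := ein2 _ _ uv; lia.
  + case: cuv => [uv|[uv|[] [uE vE]]]; try by rewrite uE vE in xu uy yv; lia.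
      by have [] := ein2 _ _ xy; have [] := ein1 _ _ uv; lia.
    exact: (ex2 x y u v).
Qed.

Lemma join_restrl E1 E2 : nctree a j E1 -> nctree j' k E2 ->
  restr a j (E1 :|: E2 :|: edge a k) = E1.
Proof.
case=> es1 ei1 ein1 ec1 eb1 ex1 [es2 ei2 ein2 ec2 eb2 ex2].
apply/setP=> -[x y]; rewrite !inE !xpair_eqE /=; apply/idP/idP.
  case/andP=> /orP[/orP[//|xy]|/orP[]/andP[/eqP xE /eqP yE]] h; try by rewrite xE yE in h; have := jk; lia.
  by have [h1 h2 h3 h4] := ein2 _ _ xy; lia.
by move=> xy; have [h1 h2 h3 h4] := ein1 _ _ xy; rewrite xy /=; lia.
Qed.

Lemma join_restrr E1 E2 : nctree a j E1 -> nctree j' k E2 ->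
  restr j' k (E1 :|: E2 :|: edge a k) = E2.
Proof.
case=> es1 ei1 ein1 ec1 eb1 ex1 [es2 ei2 ein2 ec2 eb2 ex2].
apply/setP=> -[x y]; rewrite !inE !xpair_eqE /=; apply/idP/idP.
  case/andP=> /orP[/orP[xy|//]|/orP[]/andP[/eqP xE /eqP yE]] h; try by rewrite xE yE in h; have := jk; lia.
  by have [h1 h2 h3 h4] := ein1 _ _ xy; lia.
by move=> xy; have [h1 h2 h3 h4] := ein2 _ _ xy; rewrite xy orbT /=; lia.
Qed.

(** This recovers [j] from the glued graph, as the end of the component of [a] after deleting [a k];
    it gives the uniqueness of the decomposition. *)
Lemma join_connect E1 E2 (z : V) : nctree a j E1 -> nctree j' k E2 ->
  a <= z <= k ->
  connect (cut_edge (adj (E1 :|: E2 :|: edge a k)) a k) a z = (z <= j).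
Proof.
case=> es1 ei1 ein1 ec1 eb1 ex1 [es2 ei2 ein2 ec2 eb2 ex2] hz.
apply/idP/idP => [c | zj].
  apply: (connect_inv (P := fun z : V => z <= j)) c _ => // u v uj.
  rewrite /cut_edge !adjU adj_edge !xpair_eqE -negb_or -orbA.
  case/andP=> /or3P[uv|uv|->] // _; first by have [] := ein1 _ _ uv.
  by have [] := ein2 _ _ uv; lia.
have: connect (adj E1) a z by apply: ec1; lia.
apply: connect_mono => u v uv; have [h1 h2 h3 h4] := ein1 _ _ uv.
rewrite /cut_edge !adjU uv !xpair_eqE /=.
by apply/andP; split; apply/negP => /andP[/eqP ? /eqP ?]; subst; lia.
Qed.

End Join.

(** Deleting [a k] leaves the components of [a] and of [k]. Non-crossing forces the component of [a]
    to be an initial interval, whose last point is [j]. *)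
Lemma unjoin (a k : V) E : nctree a k E -> a < k -> adj E a k ->
  exists j j' : V, [/\ a <= j, j' = j.+1 :> nat & j < k] /\
  [/\ nctree a j (restr a j E), nctree j' k (restr j' k E) &
      restr a j E :|: restr j' k E :|: edge a k = E].
Proof.
move=> T ak adjak; case: (T) => es ei ein ec eb ex.
set e := cut_edge (adj E) a k.
have esym : symmetric e by apply: cut_sym.
have csym : connect_sym e by apply: sym_connect_sym.
have eE u v : e u v -> adj E u v by apply: cut_sub.
have nak : ~ connect e a k by apply: eb.
(* Follow a path of [E] from [a] to [x]: each use of the deleted edge lands on [a] or [k], from
   which the walk restarts. *)
have AK x : a <= x <= k -> connect e a x || connect e k x.
  move=> hx; have c : connect (adj E) a x by apply: ec; lia.
  apply: (connect_inv (P := fun x => connect e a x || connect e k x)) c _.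
    move=> u v h uv; case: (boolP ((u, v) == (a, k))) => [/eqP[_ ->]|n1].
      by rewrite connect0 orbT.
    case: (boolP ((u, v) == (k, a))) => [/eqP[_ ->]|n2]; first by rewrite connect0.
    have uve : connect e u v by apply: connect1; rewrite /e /cut_edge uv n1.
    by case/orP: h => h; rewrite (connect_trans h uve) ?orbT.
  by rewrite connect0.
have nAK x : connect e a x -> ~ connect e k x.
  by move=> ax; rewrite csym => kx; apply/nak/(connect_trans ax).
have convex (x y : V) : a <= x -> x < y -> y <= k -> connect e a y -> connect e a x.
  move=> ax xy yk ay; have /orP[//|kx] : connect e a x || connect e k x by apply: AK; lia.
  have nax : ~ connect e a x by move=> /nAK.
  (* An edge [u v] of the component of [a] passing over the vertex [x] of the
     component of [k] would separate [x] from [k]. *)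
  have step u v : connect e a u /\ u < x -> e u v -> connect e a v /\ v < x.
    case=> au ux uv; have av := connect_trans au (connect1 uv); split=> //.
    case: (ltngtP v x) => // [xv|/val_inj vx]; last by rewrite vx in av.
    have [] := ein _ _ (eE _ _ uv) => _ _ _ vk.
    suff: connect e k k /\ u < k < v by case=> _; lia.
    apply: (connect_inv (P := fun z : V => connect e k z /\ u < z < v) (x := x)).
    + move=> z w [kz /andP[uz zv]] zw; have kw := connect_trans kz (connect1 zw).
      split=> //; case: (ltngtP u w) => [uw|wu|/val_inj uw]; last first.
      * by case: (nAK u au); rewrite uw.
      * by case: (ex w z u v wu uz zv); rewrite es; split; apply: eE.
      case: (ltngtP w v) => [//|vw|/val_inj vw]; last by case: (nAK v av); rewrite -vw.
      by case: (ex u v z w uz zv vw); split; apply: eE.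
    + by rewrite csym.
    + by split=> //; lia.
  suff: connect e a y /\ y < x by case=> _; lia.
  apply: (connect_inv (P := fun z : V => connect e a z /\ z < x)) ay _ => //.
  split=> //; rewrite ltn_neqAle ax andbT; apply/eqP => /val_inj axE.
  by apply: nax; rewrite -axE.
have Ain (z : V) : connect e a z -> a <= z < k.
  move=> az; rewrite ltn_neqAle.
  have -> : val z != k by apply/eqP=> /val_inj zk; apply: nak; rewrite -zk.
  apply: (connect_inv (P := fun z : V => a <= z <= k)) az _ => [u v _ /eE/ein[]|]; lia.
(* With [j] the last vertex of the component of [a], [convex] makes this component the whole of
   [[a, j]]. *)
have [j aj jmax] := arg_maxnP (fun z : V => z : nat) (connect0 e a : connect e a a).
have [j1 jk] := andP (Ain _ aj).
have AE (z : V) : a <= z <= k -> connect e a z = (z <= j).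
  case/andP=> az zk; apply/idP/idP => [/jmax //|zj].
  case: (ltngtP z j) zj => // [zj _|/val_inj -> //]; apply: (convex z j) => //; lia.
have jN : j.+1 < N.+1 by have := ltn_ord k; lia.
exists j, (Ordinal jN); split; first by [].
have eA u v : e u v -> (u <= j) = (v <= j).
  move=> uv; have [u1 u2 v1 v2] := ein _ _ (eE _ _ uv); rewrite -!AE ?u1 ?v1 //.
  apply/idP/idP => h; first exact: connect_trans h (connect1 uv).
  by apply: connect_trans h _; rewrite csym; apply: connect1.
split.
- apply: nctree_restr T _.
  suff h (z : V) : a <= z <= j -> connect (adj (restr a j E)) a z.
    move=> x y /h xa /h; apply: connect_trans; rewrite sym_connect_sym // => u v.
    by rewrite !adj_restr es [in LHS](andbC (_ <= u <= _)).
  move=> zj; have: connect e a z by rewrite AE; lia.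
  move=> c.
  have [//] : connect (adj (restr a j E)) a z /\ a <= z <= j.
  apply: (connect_inv (P := fun z : V => connect (adj (restr a j E)) a z /\ a <= z <= j)) c _.
    move=> u v [cu uj] uv; have [u1 u2 v1 v2] := ein _ _ (eE _ _ uv).
    have vj : v <= j by rewrite -(eA _ _ uv); lia.
    split; last lia; apply: connect_trans cu _; apply: connect1.
    by rewrite adj_restr eE //=; lia.
  by split; rewrite ?connect0 //; lia.
- apply: nctree_restr T _ => /=.
  suff h (z : V) : j < z <= k -> connect (adj (restr j.+1 k E)) k z.
    move=> x y /h xa /h; apply: connect_trans; rewrite sym_connect_sym // => u v.
    by rewrite !adj_restr es [in LHS](andbC (_ <= u <= _)).
  move=> zj; have c : connect e k z.
    have /orP[|//] : connect e a z || connect e k z by apply: AK; lia.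
    by rewrite AE; lia.
  have [//] : connect (adj (restr j.+1 k E)) k z /\ j < z <= k.
  apply: (connect_inv (P := fun z : V => connect (adj (restr j.+1 k E)) k z /\ j < z <= k)) c _.
    move=> u v [cu uj] uv; have [u1 u2 v1 v2] := ein _ _ (eE _ _ uv).
    have vj : ~~ (v <= j) by rewrite -(eA _ _ uv); lia.
    split; last lia; apply: connect_trans cu _; apply: connect1.
    by rewrite adj_restr eE //=; lia.
  by split; rewrite ?connect0 //; lia.
- apply/setP=> -[x y]; rewrite !inE /=; apply/idP/idP.
    case/orP=> [/orP[/andP[]|/andP[]] //|/orP[]/eqP[-> ->]] //.
    by move: adjak; rewrite es.
  move=> xy; have [x1 x2 y1 y2] := ein _ _ xy; rewrite xy /=.
  case: ((x, y) =P (a, k)) => [_|/eqP n1]; first by rewrite orbT.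
  case: ((x, y) =P (k, a)) => [_|/eqP n2]; first by rewrite !orbT.
  have /eA xyj : e x y by rewrite /e /cut_edge /adj xy n1.
  by rewrite !orbF; lia.
Qed.

End Trees.

(** * Counting h-avoiding trees on an interval of points *)

(** The hypotheses say that gluing is well defined, onto and injective on a dependent sum. Both tree
    decompositions below are instances. *)
Lemma card_glue (I T : finType) (P : pred I) (B C : I -> {set T})
    (Z : {set T}) (f : I -> T -> T -> T) :
  (forall i x y, P i -> x \in B i -> y \in C i -> f i x y \in Z) ->
  (forall z, z \in Z -> exists i x y,
     [/\ P i, x \in B i, y \in C i & f i x y = z]) ->
  (forall i j x y x' y', P i -> P j -> x \in B i -> y \in C i ->
     x' \in B j -> y' \in C j -> f i x y = f j x' y' ->
     [/\ i = j, x = x' & y = y']) ->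
  #|Z| = \sum_(i | P i) #|B i| * #|C i|.
Proof.
move=> fZ fonto finj.
pose W := [set w : I * (T * T) | P w.1 && ((w.2.1 \in B w.1) && (w.2.2 \in C w.1))].
have -> : Z = [set f w.1 w.2.1 w.2.2 | w in W].
  apply/setP=> z; apply/idP/imsetP => [/fonto[i [x [y [Pi xB yC <-]]]]|].
    by exists (i, (x, y)); rewrite // inE /= Pi xB.
  by case=> -[i [x y]]; rewrite inE /= => /and3P[Pi xB yC] ->; apply: fZ.
rewrite card_in_imset => [|[i [x y]] [j [x' y']]]; last first.
  rewrite !inE /= => /and3P[Pi xB yC] /and3P[Pj x'B y'C] eqf.
  by case: (finj _ _ _ _ _ _ Pi Pj xB yC x'B y'C eqf) => -> -> ->.
rewrite -sum1_card (eq_bigl _ _ (fun w => in_set _ w)).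
rewrite -(pair_big_dep P (fun i q => (q.1 \in B i) && (q.2 \in C i)) (fun _ _ => 1)) /=.
apply: eq_bigr => i _; rewrite -cardsX -sum1_card.
by apply: eq_bigl => q; rewrite inE.
Qed.

Section Count.
Variable N : nat.
Notation V := 'I_N.+1.
Notation graph := {set V * V}.
Implicit Types (E : graph) (S : {set V}) (x y s : V) (a b : nat).

(* A labelling is encoded by the set of the points whose label exceeds the
   label of the preceding point, so that the edge between [x < y] is not level
   iff the set meets the interval from [x + 1] to [y]. *)
Definition rises S x y : Prop := exists2 s, s \in S & x < s <= y.

(** The root [a] itself is kept out of the set of rises: only label steps inside the interval count,
    and each labelling up to a constant has one code. *)
Definition rtree a b : {set graph * {set V}} :=
  [set T : graph * {set V} | `[<
     [/\ nctree a b T.1, forall s, s \in T.2 -> a < s <= b &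
     forall x y, adj T.1 x y -> x < y -> rises T.2 x y] >]].

Definition rtree_edge (a k : V) : {set graph * {set V}} :=
  [set T in rtree a k | adj T.1 a k].

(** Exempting [a k] from the rise condition makes the two pieces left by its deletion, and the step
    between them, independent choices. *)
Definition rtree_free (a k : V) : {set graph * {set V}} :=
  [set T : graph * {set V} | `[<
     [/\ nctree a k T.1, adj T.1 a k, forall s, s \in T.2 -> a < s <= k &
     forall x y, adj T.1 x y -> x < y -> (x, y) != (a, k) -> rises T.2 x y] >]].

Lemma risesUl S1 S2 x y : rises S1 x y -> rises (S1 :|: S2) x y.
Proof. by case=> s sS xsy; exists s; rewrite // inE sS. Qed.

Lemma risesUr S1 S2 x y : rises S2 x y -> rises (S1 :|: S2) x y.
Proof. by rewrite setUC; apply: risesUl. Qed.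

Definition sbetween a b S : {set V} := [set s in S | a < s <= b].

Lemma sbetweenU a b S1 S2 :
  sbetween a b (S1 :|: S2) = sbetween a b S1 :|: sbetween a b S2.
Proof. by apply/setP => s; rewrite !inE andb_orl. Qed.

Lemma sbetween_id a b S : (forall s, s \in S -> a < s <= b) -> sbetween a b S = S.
Proof. by move=> Sab; apply/setP => s; rewrite inE; case: (boolP (s \in S)) => // /Sab. Qed.

Lemma sbetween0 a b c d S : (forall s, s \in S -> a < s <= b) ->
  b <= c \/ d <= a -> sbetween c d S = set0.
Proof.
move=> Sab h; apply/setP => s; rewrite !inE; apply/negP => /andP[/Sab]; lia.
Qed.

Lemma rtree_restr a b c d E S : (E, S) \in rtree a b ->
  nctree c d (restr c d E) -> (restr c d E, sbetween c d S) \in rtree c d.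
Proof.
rewrite inE => /asboolP[/= _ _ rS] T; rewrite inE; apply/asboolP; split=> //=.
  by move=> s; rewrite inE => /andP[].
move=> x y; rewrite adj_restr => /andP[xy cd] xlty.
have [s sS xsy] := rS _ _ xy xlty; exists s => //; rewrite inE sS /=; lia.
Qed.

Lemma card_rtree1 (a : V) : #|rtree a a| = 1.
Proof.
rewrite -(cards1 (set0 : graph, set0 : {set V})); congr #|pred_of_set _|.
apply/setP => -[E S]; rewrite !inE; apply/asboolP/eqP => /= [[/nctree1 -> Sa _]|[-> ->]].
  congr pair; apply/setP => s; rewrite inE; apply/negP => /Sa; lia.
split; first exact/nctree1; first by move=> s; rewrite inE.
by move=> x y; rewrite /adj inE.
Qed.

(** Cut at the largest neighbour [k] of the root [a]: the two parts form a wedge at [k]. *)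
Lemma card_rtree (a : V) b : a < b -> b <= N ->
  #|rtree a b| = \sum_(k : V | a < k <= b) #|rtree_edge a k| * #|rtree k b|.
Proof.
move=> ab bN.
apply: (@card_glue _ _ (fun k : V => a < k <= b) (rtree_edge a) (fun k : V => rtree k b)
  _ (fun _ T1 T2 => (T1.1 :|: T2.1, T1.2 :|: T2.2))).
- move=> k [E1 S1] [E2 S2] /andP[ak kb]; rewrite !inE /=.
  case/andP=> /asboolP[T1 S1in S1r] ak1 /asboolP[T2 S2in S2r]; apply/asboolP.
  split=> /=; first by apply: wedge T1 T2 => //; exact: ltnW.
    by move=> s; rewrite inE => /orP[/S1in|/S2in]; lia.
  move=> x y; rewrite adjU => /orP[] xy xlty.
    exact/risesUl/S1r.
  exact/risesUr/S2r.
- move=> [E S] TX; have := TX; rewrite inE => /asboolP[/= T Sin Sr].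
  case: (T) => es ei ein ec eb ex.
  (* Without neighbours [a] would be its own component, but it is connected to [b]. *)
  have [k0 k0P] : exists k, adj E a k.
    have [/existsP //|/existsPn noa] := boolP [exists k, adj E a k].
    have bN' : b < N.+1 by [].
    have c : connect (adj E) a (Ordinal bN') by apply: ec; rewrite leqnn ltnW.
    suff : Ordinal bN' = a by move/(congr1 val) => /=; lia.
    apply: (connect_inv (P := fun z => z = a)) c _ => // u v ->.
    by rewrite (negPf (noa v)).
  have [k ak kmax] := arg_maxnP (fun z : V => z : nat) (k0P : adj E a k0).
  have alt z : adj E a z -> a < z.
    move=> az; have [h1 h2 h3 h4] := ein _ _ az; rewrite ltn_neqAle h3 andbT.
    by apply/eqP => /val_inj aE; rewrite -aE ei in az.
  have akl := alt _ ak; have [_ _ _ kb] := ein _ _ ak.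
  have [|T1 T2 EE] := unwedge (ltnW akl) kb T.
    (* An edge over [k] either starts after [a] and crosses [a k], or starts at [a] and contradicts
       the maximality of [k]. *)
    move=> x y xy /andP[xk ky]; have [ax _ _ _] := ein _ _ xy.
    case: (ltngtP a x) ax => // [ax _|/val_inj aE _]; first exact: (ex a k x y).
    by rewrite -aE in xy; have /= := kmax _ xy; lia.
  exists k, (restr a k E, sbetween a k S), (restr k b E, sbetween k b S); split.
  + by rewrite akl kb.
  + rewrite inE /= (rtree_restr TX) // adj_restr ak /=; lia.
  + exact: rtree_restr TX _.
  + rewrite /= EE; congr pair; apply/setP => s; rewrite !inE.
    by case: (boolP (s \in S)) => //= /Sin; lia.
- move=> k k' [E1 S1] [E2 S2] [E1' S1'] [E2' S2'] /andP[ak kb] /andP[ak' kb'].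
  rewrite !inE /= => /andP[/asboolP[/= T1 S1in _] ak1] /asboolP[/= T2 S2in _].
  case/andP=> /asboolP[/= T1' S1in' _] ak1' /asboolP[/= T2' S2in' _] [eE eS].
  have kk' : k = k'.
    (* In a wedge at [l'] with [a < l'], every neighbour of [a] is at most [l']; two decompositions
       of one tree thus bound each other's cut point. *)
    have h (l : V) F1 F2 (l' : V) F1' F2' : adj F1 a l -> F1 :|: F2 = F1' :|: F2' ->
        nctree a l' F1' -> nctree l' b F2' -> a < l' -> l <= l'.
      move=> al eF T1F T2F al'; have : adj (F1 :|: F2) a l by rewrite adjU al.
      by rewrite eF adjU => /orP[/(nc_in T1F)|/(nc_in T2F)] []; lia.
    apply/val_inj/eqP; rewrite eqn_leq (h _ _ _ _ _ _ ak1 eE) //=.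
    exact: (h _ _ _ _ _ _ ak1' (esym eE)).
  subst k'; split=> //.
  + rewrite -(wedge_restrl (ltnW ak) kb T1 T2) eE (wedge_restrl (ltnW ak) kb T1' T2'); congr pair.
    rewrite -(sbetween_id S1in) -[RHS](sbetween_id S1in').
    have := congr1 (sbetween a k) eS.
    by rewrite !sbetweenU (sbetween0 S2in) ?(sbetween0 S2in') ?setU0; auto.
  + rewrite -(wedge_restrr (ltnW ak) kb T1 T2) eE (wedge_restrr (ltnW ak) kb T1' T2').
    congr pair; rewrite -(sbetween_id S2in) -[RHS](sbetween_id S2in').
    have := congr1 (sbetween k b) eS.
    by rewrite !sbetweenU (sbetween0 S1in) ?(sbetween0 S1in') ?set0U; auto.
Qed.

(** Delete [a k] and record the gap [j]. The factor 2 is the free choice whether the label rises at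
    [j.+1], a point allowed in neither of the smaller rise sets. *)
Lemma card_rtree_free (a k : V) : a < k ->
  #|rtree_free a k| = 2 * \sum_(j : V | a <= j < k) #|rtree a j| * #|rtree j.+1 k|.
Proof.
move=> ak.
pose step (i : V * bool) : {set V} := if i.2 then [set inord i.1.+1] else set0.
have stepP (j : V) c s : j < k -> (s \in step (j, c)) = c && (s == j.+1 :> nat).
  move=> jk; have jN : j.+1 < N.+1 by have := ltn_ord k; lia.
  rewrite /step; case: c; rewrite inE //=; apply/eqP/eqP => [->|sj].
    exact: inordK.
  by apply/val_inj; rewrite /= inordK.
rewrite (@card_glue _ _ (fun i : V * bool => a <= i.1 < k) (fun i => rtree a i.1)
  (fun i => rtree i.1.+1 k) _
  (fun i T1 T2 => (T1.1 :|: T2.1 :|: edge a k, T1.2 :|: T2.2 :|: step i))).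
- transitivity (\sum_(j : V | a <= j < k) \sum_(c : bool) #|rtree a j| * #|rtree j.+1 k|).
    by rewrite pair_big_dep; apply: eq_bigl => i; rewrite andbT.
  by rewrite big_distrr; apply: eq_bigr => j _; rewrite sum_nat_const card_bool.
- move=> [j c] [E1 S1] [E2 S2] /= /andP[aj jk]; rewrite !inE /=.
  case/asboolP=> /= T1 S1in S1r /asboolP[/= T2 S2in S2r]; apply/asboolP.
  have jN : j.+1 < N.+1 by have := ltn_ord k; lia.
  split=> /=.
  + exact: (join (j' := Ordinal jN) aj erefl jk T1 T2).
  + by rewrite adjU adj_edge !eqxx orbT.
  + move=> s; rewrite 2!inE stepP // => /orP[/orP[/S1in|/S2in]|/andP[_ /eqP]]; lia.
  + move=> x y; rewrite !adjU => /orP[/orP[]|] xy xlty neq.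
    * exact/risesUl/risesUl/S1r.
    * exact/risesUl/risesUr/S2r.
    * move: xy; rewrite adj_edge => /orP[]/andP[/eqP xE /eqP yE].
        by rewrite xE yE eqxx in neq.
      by rewrite xE yE in xlty; lia.
- move=> [E S]; rewrite inE => /asboolP[/= T adjak Sin Sr].
  have [j [j' [[aj jj jk] [T1 T2 EE]]]] := unjoin T ak adjak.
  pose c := [exists s, (s \in S) && (s == j.+1 :> nat)].
  exists (j, c), (restr a j E, sbetween a j S), (restr j' k E, sbetween j' k S).
  split=> /=; first by rewrite aj.
  + rewrite inE; apply/asboolP; split=> //= [s|x y]; first by rewrite inE => /andP[].
    rewrite adj_restr => /andP[xy cd] xlty.
    have [|s sS xsy] := Sr _ _ xy xlty; last by exists s => //; rewrite inE sS /=; lia.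
    by apply/eqP => -[_ yE]; rewrite yE in cd; lia.
  + rewrite -jj inE; apply/asboolP; split=> //= [s|x y]; first by rewrite inE => /andP[].
    rewrite adj_restr => /andP[xy cd] xlty.
    have [|s sS xsy] := Sr _ _ xy xlty; last by exists s => //; rewrite inE sS /=; lia.
    by apply/eqP => -[xE _]; rewrite xE in cd; lia.
  (* A point of [S] is at most [j], greater than [j.+1], or equal to [j.+1]; the flag [c] records
     the last case. *)
  + rewrite EE; congr pair; apply/setP => s; rewrite 3!inE [in X in _ || X || _]inE stepP //.
    case: (boolP (s \in S)) => [sS|nsS] /=; last first.
      apply/negP => /andP[/existsP[t /andP[tS /eqP tj]] /eqP sj].
      by move: nsS; rewrite (_ : s = t) ?tS //; apply/val_inj; rewrite /= sj.
    case: (s =P j.+1 :> nat) => [sj|sj]; last by have := Sin _ sS; lia.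
    by rewrite andbT (_ : c) ?orbT //; apply/existsP; exists s; rewrite sS sj eqxx.
- move=> [j c] [j2 c2] [E1 S1] [E2 S2] [E1' S1'] [E2' S2'] /=.
  case/andP=> aj jk /andP[aj2 jk2]; rewrite !inE /=.
  move=> /asboolP[/= T1 S1in _] /asboolP[/= T2 S2in _].
  move=> /asboolP[/= T1' S1in' _] /asboolP[/= T2' S2in' _] [eE eS].
  have jN (i : V) : i < k -> i.+1 < N.+1 by have := ltn_ord k; lia.
  have jj2 : j = j2.
    have h (i l : V) F1 F2 F1' F2' : a <= i < k -> a <= l < k ->
        F1 :|: F2 :|: edge a k = F1' :|: F2' :|: edge a k ->
        nctree a i F1 -> nctree i.+1 k F2 -> nctree a l F1' -> nctree l.+1 k F2' ->
        i <= l.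
      move=> /andP[ai ik] /andP[al lk] eF Ti1 Ti2 Tl1 Tl2; have hi : a <= i <= k by lia.
      have := join_connect (j' := Ordinal (jN _ lk)) al erefl lk Tl1 Tl2 hi.
      rewrite -eF (join_connect (j' := Ordinal (jN _ ik)) ai erefl ik Ti1 Ti2 hi).
      by rewrite leqnn.
    apply/val_inj/eqP; rewrite eqn_leq (h _ _ E1 E2 E1' E2') ?aj ?aj2 //=.
    by rewrite (h _ _ E1' E2' E1 E2) ?aj ?aj2.
  subst j2.
  have Dl := join_restrl (j' := Ordinal (jN _ jk)) aj erefl jk.
  have Dr := join_restrr (j' := Ordinal (jN _ jk)) aj erefl jk.
  have memS s := congr1 (fun S : {set V} => s \in S) eS.
  split.
  (* Membership of [j.+1] in the common rise set reads off the flag. *)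
  + congr pair; have := memS (Ordinal (jN _ jk)).
    rewrite !inE /= !stepP //= eqxx !andbT.
    have n1 S l m : (forall s, s \in S -> l < s <= m) -> (j.+1 <= l) || (m <= j) ->
        (Ordinal (jN _ jk) \in S) = false.
      by move=> h hl; apply/negP => /h /=; lia.
    by rewrite (n1 _ _ _ S1in) ?(n1 _ _ _ S2in) ?(n1 _ _ _ S1in') ?(n1 _ _ _ S2in') ?leqnn ?orbT.
  + rewrite -(Dl _ _ T1 T2) eE (Dl _ _ T1' T2'); congr pair.
    apply/setP => s; have := memS s; rewrite !inE !stepP //.
    case: (ltnP j s) => [js _|sj].
      by apply/idP/idP => [/S1in|/S1in']; lia.
    have -> : (s \in S2) = false by apply/negP => /S2in; lia.
    have -> : (s \in S2') = false by apply/negP => /S2in'; lia.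
    have -> : (s == j.+1 :> nat) = false by lia.
    by rewrite !andbF !orbF.
  + rewrite -(Dr _ _ T1 T2) eE (Dr _ _ T1' T2'); congr pair.
    apply/setP => s; have := memS s; rewrite !inE !stepP //.
    case: (leqP s j.+1) => [js _|sj].
      by apply/idP/idP => [/S2in|/S2in']; lia.
    have -> : (s \in S1) = false by apply/negP => /S1in; lia.
    have -> : (s \in S1') = false by apply/negP => /S1in'; lia.
    have -> : (s == j.+1 :> nat) = false by lia.
    by rewrite !andbF !orbF.
Qed.

(** If [a k] has no rise then [S] is empty, so no other edge can have one either. The tree is then
    the single edge [a k], which spans its interval only for [k = a + 1]. *)
Lemma card_rtree_edge (a k : V) : a < k ->
  #|rtree_edge a k| + (k == a.+1 :> nat) =
  2 * \sum_(j : V | a <= j < k) #|rtree a j| * #|rtree j.+1 k|.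
Proof.
move=> ak; rewrite -card_rtree_free //.
rewrite -(cardsID (rtree_edge a k) (rtree_free a k)); congr (_ + _).
  congr #|pred_of_set _|; apply/setP => -[E S]; rewrite !inE /=.
  apply/andP/andP => [[/asboolP[T Sin Sr] adjak]|[_ /andP[]] //].
  split; last by rewrite adjak andbT; apply/asboolP.
  by apply/asboolP; split=> // x y xy xlty _; exact: Sr.
have -> : rtree_free a k :\: rtree_edge a k =
    if k == a.+1 :> nat then [set (edge a k, set0)] else set0.
  apply/setP => -[E S]; rewrite 2!inE; apply/idP/idP.
    case/andP=> nr; rewrite inE => /asboolP[/= T adjak Sin Sr].
    have S0 : S = set0.
      apply/setP => s; rewrite inE; apply/negP => sS; case/negP: nr.
      rewrite inE /= adjak andbT; apply/asboolP; split=> //= x y xy xlty.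
      case: (boolP ((x, y) == (a, k))) => [/eqP[-> ->]|]; last exact: Sr.
      by exists s => //; apply: Sin.
    have Ea x y : adj E x y -> x < y -> (x, y) = (a, k).
      move=> xy xlty; apply/eqP/negPn/negP => neq.
      by have [s] := Sr _ _ xy xlty neq; rewrite S0 inE.
    have EE : E = edge a k.
      have [es ei _ _ _ _] := T.
      apply/setP => -[x y]; rewrite inE; apply/idP/idP => [xy|/orP[]/eqP[-> ->] //].
        case: (ltngtP x y) => [xly|ylx|/val_inj xE].
        - by rewrite (Ea x y) ?eqxx.
        - by have [-> ->] : (y, x) = (a, k) by [apply: Ea; rewrite // es]; rewrite eqxx orbT.
        - by have := ei x; rewrite /adj {2}xE xy.
      by move: adjak; rewrite es.
    rewrite EE S0; case: eqP => ka; first by rewrite inE.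
    (* Otherwise the point [a.+1] lies strictly between [a] and [k] and cannot be reached by the
       single edge. *)
    have aN : a.+1 < N.+1 by have := ltn_ord k; lia.
    have : connect (adj E) a (Ordinal aN) by apply: (nc_conn T) => /=; lia.
    move=> c; suff [] : Ordinal aN = a \/ Ordinal aN = k by move/(congr1 val) => /=; lia.
    apply: (connect_inv (P := fun z => z = a \/ z = k)) c _; last by left.
    by move=> u v _; rewrite EE adj_edge => /orP[]/andP[_ /eqP]; auto.
  case: eqP => ka; rewrite inE // => /eqP[-> ->]; apply/andP; split.
    rewrite inE /=; apply/negP => /andP[/asboolP[/= _ _ Sr] aka].
    by have [s] := Sr _ _ aka ak; rewrite inE.
  rewrite inE; apply/asboolP; split=> /=.
  (* The single edge is the join of two one-point trees, with [j = a] and [j' = k]. *)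
  - have := @join _ a k a k (leqnn a) ka ak set0 set0.
    by rewrite !set0U; apply; apply/nctree1.
  - by rewrite adj_edge !eqxx.
  - by move=> s; rewrite inE.
  - move=> x y; rewrite adj_edge => /orP[]/andP[/eqP-> /eqP->]; rewrite ?eqxx //; lia.
by case: eqP => _; rewrite ?cards1 ?cards0.
Qed.

End Count.

(** * Avoiding the one-letter word [h] means having no level edge *)

Section Avoid.
Variables (n : nat) (E : {set 'I_n.+1 * 'I_n.+1}) (l : 'I_n.+1 -> nat).

Lemma edge_letter_level p c : edge_letter p c = Level <-> p = c.
Proof.
rewrite /edge_letter; case: ltngtP => [h|h|->]; split=> // pc;
  by rewrite pc ltnn in h.
Qed.

Lemma path_level x p : path (adj E) x p ->
  Level \in pairmap (fun x y => edge_letter (l x) (l y)) x p ->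
  exists u v, adj E u v /\ l u = l v.
Proof.
elim: p x => //= y p IHp x /andP[xy yp]; rewrite inE => /orP[/eqP/esym|]; last exact: IHp.
by move/edge_letter_level=> lxy; exists x, y.
Qed.

(** Every edge [x y] is the last edge of some root path, in one of its two directions; the direction
    is immaterial because being level is symmetric. *)
Lemma avoids_level : symmetric (adj E) -> irreflexive (adj E) -> connected E ->
  (avoids_all E l (pred1 [:: Level]) <-> forall x y, adj E x y -> l x <> l y).
Proof.
move=> es ei ec; split=> [av x y xy lxy | nolev s /eqP -> [p [p0 _]]]; last first.
  case/infixP=> s1 [s2] wE; have : Level \in path_word l p.
    by rewrite wE mem_cat mem_cat inE eqxx orbT.
  by case/(path_level p0) => u [v [uv /nolev]]; apply.
have extend p u v : root_path E p -> last ord0 p = u -> v \notin ord0 :: p ->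
    adj E u v -> l u = l v -> False.
  case=> p0 up lastp vp uv luv; apply: (av [:: Level]); first exact: eqxx.
  exists (rcons p v).
    split; first by rewrite rcons_path p0 lastp.
    by rewrite -rcons_cons rcons_uniq vp.
  apply/infixP; exists (path_word l p), [::].
  rewrite cats0 /path_word -cats1 pairmap_cat lastp /=.
  by rewrite (edge_letter_level _ _).2.
have /connectP[p0 p0P p0x] := ec ord0 x.
case/shortenP: p0P p0x => p pP up _ px.
(* If the simple path to [x] already visits [y], cut it at [y]: the prefix misses [x], so it can be
   extended by the edge from [y] to [x]. *)
case: (boolP (y \in ord0 :: p)) => [yp|]; last by move=> yp; apply: (extend p x y).
case/splitPl: yp pP up px => p1 p2 p1y; rewrite cat_path -cat_cons cat_uniq last_cat.
case/andP=> p1P p2P /and3P[up1 disj _] xE.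
apply: (extend p1 y x) => //; last by rewrite es.
apply: contraNN disj => xp1; apply/hasP; exists x => //.
case: p2 p2P xE => [_ /= xE|z p2 _ /= ->]; last exact: mem_last.
by rewrite xE p1y ei in xy.
Qed.

End Avoid.

(** * Labellings encoded by their sets of rises *)

Section Labels.
Variable n : nat.
Notation V := 'I_n.+1.
Implicit Types (S : {set V}) (i : V).

Definition nrises S (i : nat) : nat := #|sbetween 0 i S|.

Lemma nrises_bound S i : nrises S i <= n.
Proof.
have : nrises S i <= #|[set~ ord0 : V]|.
  by apply/subset_leq_card/subsetP => s; rewrite !inE => /and3P[_ + _]; rewrite lt0n.
by rewrite cardsC1 card_ord.
Qed.

Lemma nrises_split S (x y : nat) : x <= y ->
  nrises S y = nrises S x + #|sbetween x y S|.
Proof.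
move=> xy; rewrite /nrises -(cardsID (sbetween 0 x S) (sbetween 0 y S)).
by congr (_ + _); congr #|pred_of_set _|; apply/setP => s; rewrite !inE;
  case: (s \in S); rewrite ?andbF //=; lia.
Qed.

Lemma nrises0 S : nrises S 0 = 0.
Proof. by apply/eqP; rewrite cards_eq0; apply/eqP/setP => s; rewrite !inE; lia. Qed.

Lemma nrisesS S (i : V) (k : nat) : i = k.+1 :> nat ->
  nrises S i = nrises S k + (i \in S).
Proof.
move=> ik; rewrite (@nrises_split S k i); last by lia.
congr (_ + _); case: (boolP (i \in S)) => iS; last first.
  apply/eqP; rewrite cards_eq0; apply/eqP/setP => s; rewrite !inE.
  apply/negP => /andP[sS ski]; move: iS; rewrite (_ : i = s) ?sS //.
  by apply/val_inj => /=; lia.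
suff -> : sbetween k i S = [set i] by rewrite cards1.
apply/setP => s; rewrite !inE.
apply/andP/eqP => [[_ ski]|->]; first by apply/val_inj => /=; lia.
by split=> //; lia.
Qed.

Lemma rises_nrises S (i j : V) : i < j -> rises S i j <-> nrises S i < nrises S j.
Proof.
move=> ij; rewrite (nrises_split S (ltnW ij)) -[X in X < _]addn0 ltn_add2l.
rewrite card_gt0; split=> [[s sS isj]|/set0Pn[s]].
  by apply/set0Pn; exists s; rewrite inE sS.
by rewrite inE => /andP[sS isj]; exists s.
Qed.

Definition labels S : {ffun V -> 'I_n.+2} := [ffun i : V => inord (nrises S i).+1].

Lemma labelsE (E : {set V * V}) S i : label (E, labels S) i = (nrises S i).+1.
Proof. by rewrite /label ffunE inordK // !ltnS nrises_bound. Qed.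

(** A discrete intermediate value property: the count starts at 0 and grows by at most one per
    point. *)
Lemma nrises_onto S (j : V) k : k <= nrises S j -> exists i : V, nrises S i = k.
Proof.
case: j => j jn; elim: j jn k => [|j IHj] jn k /=.
  by rewrite nrises0 leqn0 => /eqP->; exists ord0; rewrite nrises0.
rewrite leq_eqVlt => /orP[/eqP->|]; first by exists (Ordinal jn).
rewrite -[j.+1]/(nat_of_ord (Ordinal jn)) (@nrisesS S (Ordinal jn) j) // => kj.
by apply: (IHj (ltnW jn)) => /=; move: kj; case: (_ \in S); lia.
Qed.

Lemma gnc_labels E S : gnc_labelling (label (E, labels S)).
Proof.
split=> [i j ij||].
- by rewrite !labelsE ltnS (nrises_split S ij) leq_addr.
- by rewrite labelsE nrises0.
exists (nrises S n).+1 => k; split=> [[i <-]|].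
  by rewrite labelsE /= ltnS (nrises_split S (leq_ord i)) leq_addr.
case: k => // k; rewrite !ltnS /= => /(@nrises_onto S ord_max)[i ik].
by exists i; rewrite labelsE ik.
Qed.

Lemma labels_onto (E : {set V * V}) (f : {ffun V -> 'I_n.+2}) :
  gnc_labelling (label (E, f)) ->
  exists2 S : {set V}, forall s, s \in S -> 0 < s <= n & labels S = f.
Proof.
case=> mono l0 [m onto]; set l := label (E, f) in mono l0 onto.
(* A jump by two or more would skip the value [(l i).+1]. The label set has no gaps, so some point
   carries it, but monotonicity allows this neither up to [i] nor from [i.+1] on. *)
have lS (i j : V) : j = i.+1 :> nat -> l j <= (l i).+1.
  move=> ji; rewrite leqNgt; apply/negP => lij.
  have : exists k, l k = (l i).+1.
    apply/onto; have /onto/andP[_] : exists k, l k = l j by exists j.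
    lia.
  case=> k lk; case: (leqP k i) => ki; first by have := mono _ _ ki; lia.
  by have := mono j k; rewrite ji => /(_ ki); lia.
pose S := [set s : V | (0 < s) && (l (inord s.-1) < l s)].
exists S; first by move=> s; rewrite inE => /andP[-> _]; exact: leq_ord.
apply/ffunP => i; apply/val_inj.
change (label (E, labels S) i = l i); rewrite labelsE.
case: i => i; elim: i => [|i IHi] iN /=.
  by rewrite nrises0 -l0; congr l; apply/val_inj.
rewrite -[i.+1]/(nat_of_ord (Ordinal iN)) (@nrisesS S (Ordinal iN) i) //.
have := IHi (ltnW iN); rewrite inE /=; set i' := Ordinal (ltnW iN) => /= li.
have -> : inord i = i' by apply/val_inj; rewrite /= inordK // ltnW.
have := mono i' (Ordinal iN) (leqnSn _); have := lS i' (Ordinal iN) erefl.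
by rewrite -li; case: ltnP; lia.
Qed.

Lemma card_GNC_level : #|GNC_avoiding n (pred1 [:: Level])| = #|rtree n 0 n|.
Proof.
have -> : GNC_avoiding n (pred1 [:: Level]) =
    [set (T.1, labels T.2) | T in rtree n 0 n].
  apply/setP => -[E f]; apply/idP/imsetP => [|[[E' S]]].
    rewrite 2!inE => /andP[/asboolP[/= T ex lf] /asboolP/= av].
    have TT := (tree_nctree E).1 (conj T ex); case: T => -[es ei] ec _.
    have [S Sin fE] := labels_onto lf; exists (E, S); rewrite /= ?fE //.
    rewrite inE; apply/asboolP; split=> //= x y xy xlty; apply/rises_nrises => //.
    have /avoids_level := av; move/(_ es ei ec _ _ xy).
    by rewrite -fE !labelsE (nrises_split S (ltnW xlty)); lia.
  rewrite inE => /asboolP[/= TT Sin Sr] [-> ->]; rewrite 2!inE.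
  have [T ex] := (tree_nctree E').2 TT; have [[es ei] ec _] := T.
  apply/andP; split; apply/asboolP; first by split=> //; apply: gnc_labels.
  apply/avoids_level => // x y xy; rewrite !labelsE.
  case: (ltngtP x y) => [xlty|yltx|/val_inj xE]; last by rewrite xE ei in xy.
    by have /(rises_nrises _ xlty) := Sr _ _ xy xlty; lia.
  by rewrite es in xy; have /(rises_nrises _ yltx) := Sr _ _ xy yltx; lia.
rewrite card_in_imset // => -[E S] [E' S']; rewrite !inE.
move=> /asboolP[/= _ Sin _] /asboolP[/= _ Sin' _] [-> eqS]; congr pair.
(* Injectivity: for [s > 0], membership in the rise set is the difference of the counts at [s] and
   [s.-1]; the point 0 is in neither set. *)
have nE (i : V) : nrises S i = nrises S' i.
  by apply: succn_inj; rewrite -!(labelsE set0) eqS.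
apply/setP => s; case: (posnP s) => s0.
  by apply/idP/idP => [/Sin|/Sin']; rewrite s0.
have sE : s = s.-1.+1 :> nat by rewrite prednK.
have := nE s; rewrite (nrisesS S sE) (nrisesS S' sE).
have sN : s.-1 < n.+1 by have := ltn_ord s; lia.
have := nE (Ordinal sN) => /= -> /addnI.
by do 2!case: (s \in _).
Qed.

End Labels.

Lemma sum_ord_interval N (F : nat -> nat) a b : b <= N ->
  \sum_(k < N | a <= k < b) F k = \sum_(0 <= i < b - a) F (i + a).
Proof.
move=> bN; rewrite -(big_addn 0 b a xpredT F) add0n big_geq_mkord.
by rewrite (big_ord_widen_cond _ _ _ bN); apply: eq_bigl => k; rewrite /= ?andbT.
Qed.

(** * Translation invariance of the counts *)

Section Shift.
Variable n : nat.
Notation V := 'I_n.+1.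

Let card_edge a k := #|rtree_edge (inord a : V) (inord k)|.

Lemma card_rtree_nat a d : a + d < n ->
  #|rtree n a (a + d).+1| =
  \sum_(0 <= i < d.+1) card_edge a (a + i).+1 * #|rtree n (a + i).+1 (a + d).+1|.
Proof.
move=> adn; have aV : (inord a : V) = a :> nat by rewrite inordK //; lia.
rewrite -{1}aV card_rtree ?aV; [|lia..].
pose F k := card_edge a k * #|rtree n k (a + d).+1|.
transitivity (\sum_(k < n.+1 | a.+1 <= k < (a + d).+2) F k).
  by apply: eq_big => k; rewrite ?ltnS // /F /card_edge inord_val.
rewrite (sum_ord_interval F); last lia.
have -> : (a + d).+2 - a.+1 = d.+1 by lia.
by apply: eq_bigr => i _; rewrite /F addnS (addnC i).
Qed.

Lemma card_edge_nat a d : a + d < n ->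
  card_edge a (a + d).+1 + (d == 0) =
  2 * \sum_(0 <= i < d.+1) #|rtree n a (a + i)| * #|rtree n (a + i).+1 (a + d).+1|.
Proof.
move=> adn; have aV : (inord a : V) = a :> nat by rewrite inordK //; lia.
have kV : (inord (a + d).+1 : V) = (a + d).+1 :> nat by rewrite inordK.
have := @card_rtree_edge n (inord a) (inord (a + d).+1).
rewrite aV kV -[RHS]/(2 * _) => h.
have -> : (d == 0) = ((a + d).+1 == a.+1) by lia.
rewrite h; last lia.
congr (2 * _).
rewrite (sum_ord_interval (fun k => #|rtree n a k| * #|rtree n k.+1 (a + d).+1|)); last lia.
have -> : (a + d).+1 - a = d.+1 by lia.
by apply: eq_bigr => i _; rewrite (addnC i).
Qed.

(** No bijection between trees is needed: the two recurrences express the count on an interval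
    through shorter ones in a translation-invariant way, and strong induction on the length
    concludes. *)
Lemma card_rtree_shift d a : a + d <= n -> #|rtree n a (a + d)| = #|rtree n 0 d|.
Proof.
elim/ltn_ind: d a => -[_|d IHd] a adn.
  have aV : (inord a : V) = a :> nat by rewrite inordK //; lia.
  rewrite addn0 -{1 2}aV card_rtree1; symmetry; exact: (card_rtree1 (ord0 : V)).
have shift i b e : i <= d -> e = b + i -> e <= n -> #|rtree n b e| = #|rtree n 0 i|.
  by move=> id -> bn; apply: IHd.
have := @card_rtree_nat 0 d; rewrite add0n addnS in adn *.
rewrite card_rtree_nat // => ->; last lia.
apply: eq_big_nat => i /andP[_ id]; rewrite add0n.
rewrite (shift (d - i) (a + i).+1) ?(shift (d - i) i.+1); try lia.
(* Adding the correction for the level edge to both sides puts them in the form of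
   [card_edge_nat]. *)
congr (_ * _); apply: (@addIn (i == 0)).
rewrite card_edge_nat; last lia.
have := @card_edge_nat 0 i; rewrite !add0n => ->; last lia.
congr (2 * _); apply: eq_big_nat => j /andP[_ ji].
by rewrite add0n (shift j a) ?(shift (i - j) (a + j).+1) ?(shift (i - j) j.+1); lia.
Qed.

End Shift.

(** * The closed form *)

Import GRing.Theory Num.Theory.
Local Open Scope ring_scope.

(* The number [r / (3 i + r) * binomial (3 i + r) i], the coefficient of [x ^ i]
   in the [r]-th power of the solution of [T = 1 + x T ^ 3]. *)
Definition ternary (r i : nat) : rat :=
  if i is j.+1 then 'C(3 * j + r + 2, j.+1)%:R - 2 * 'C(3 * j + r + 2, j)%:R
  else 1.

Arguments ternary : simpl never.

(** The coefficient form of [T ^ (r + 1) = T ^ r + x T ^ (r + 3)]; on binomials it is Pascal's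
    rule. *)
Lemma ternary_rec r i : ternary r.+1 i.+1 = ternary r i.+1 + ternary r.+3 i.
Proof.
case: i => [|i]; rewrite /ternary; first by rewrite !muln0 !add0n !bin1 !bin0 addSn -natr1; ring.
have -> : (3 * i.+1 + r.+1 + 2 = (3 * i.+1 + r + 2).+1)%N by lia.
have -> : (3 * i + r.+3 + 2 = 3 * i.+1 + r + 2)%N by lia.
by rewrite !binS !natrD; ring.
Qed.

Lemma ternary0 i : ternary 0 i.+1 = 0.
Proof.
have h : (i.+1 * 'C(3 * i + 2, i.+1) = i.+1 * (2 * 'C(3 * i + 2, i)))%N.
  by rewrite mul_bin_left mulnA; congr (_ * _)%N; lia.
by rewrite /ternary addn0; move/eqP: h; rewrite eqn_pmul2l // => /eqP->; rewrite natrM subrr.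
Qed.

Lemma ternary1 i : ternary 1 i = 'C(3 * i, i)%:R / (2 * i + 1)%:R.
Proof.
case: i => [|i]; rewrite /ternary; first by rewrite bin0 divr1.
have -> : (3 * i + 1 + 2 = 3 * i.+1)%N by lia.
have nz : (2 * i.+1 + 1)%:R != 0 :> rat by rewrite pnatr_eq0; lia.
apply: (mulIf nz); rewrite divfK //.
have h := mul_bin_left (3 * i.+1) i.
have {}h : (i.+1%:R * 'C(3 * i.+1, i.+1)%:R = (2 * i.+1 + 1)%:R * 'C(3 * i.+1, i)%:R :> rat).
  by rewrite -!natrM h; congr (_%:R); congr (_ * _)%N; lia.
rewrite mulrBl -[X in _ - X = _]mulrA (mulrC 'C(3 * i.+1, i)%:R) -h.
by rewrite natrD natrM; ring.
Qed.

(* The coefficient of [x ^ n] in [(1 + x) ^ - r * T (2 x / (1 + x) ^ 3) ^ r]. *)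
Definition gnc_coef (r n : nat) : rat :=
  \sum_(0 <= i < n.+1) 2 ^+ i * ternary r i * (-1) ^+ (n - i) *
     'C(n + 2 * i + r - 1, n - i)%:R.

Lemma gnc_coef_n0 r : gnc_coef r 0 = 1.
Proof. by rewrite /gnc_coef /ternary big_nat1 /= bin0; ring. Qed.

Lemma gnc_coef_0S n : gnc_coef 0 n.+1 = 0.
Proof.
rewrite /gnc_coef big_nat_recl // big1_seq => [|i _]; last by rewrite ternary0; ring.
(* Only the term [i = 0] is left, and its binomial is ['C(n, n.+1)]. *)
rewrite bin_small; last by lia.
by ring.
Qed.

(** Pascal's rule with alternating signs merges the two sums on the left into one; [ternary_rec]
    then splits each of its terms with positive index into one for [r] and one for [r + 3]. *)
Lemma gnc_coef_rec r n :
  gnc_coef r.+1 n.+1 + gnc_coef r.+1 n = gnc_coef r n.+1 + 2 * gnc_coef r.+3 n.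
Proof.
have -> : gnc_coef r.+1 n.+1 + gnc_coef r.+1 n =
    \sum_(0 <= i < n.+2) 2 ^+ i * ternary r.+1 i * (-1) ^+ (n.+1 - i) *
      'C(n + 2 * i + r, n.+1 - i)%:R.
  rewrite /gnc_coef !(big_nat_recr n.+1) //= -addrA [X in _ + X]addrC addrA.
  rewrite -big_split /=; congr (_ + _); last by rewrite subnn !bin0.
  apply: eq_big_nat => i /andP[_ iN]; rewrite (@subSn i n iN).
  have -> : (n.+1 + 2 * i + r.+1 - 1 = (n + 2 * i + r).+1)%N by lia.
  have -> : (n + 2 * i + r.+1 - 1 = n + 2 * i + r)%N by lia.
  by rewrite binS natrD exprS; ring.
rewrite big_nat_recl // /gnc_coef [in RHS]big_nat_recl // -!addrA; congr (_ + _).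
  by rewrite /ternary; congr (_ * _%:R); congr 'C(_, _); lia.
rewrite big_distrr -big_split /=; apply: eq_big_nat => i _.
rewrite ternary_rec subSS exprS.
have -> : (n + 2 * i.+1 + r = n + 2 * i + r.+3 - 1)%N by lia.
have -> : (n.+1 + 2 * i.+1 + r - 1 = n + 2 * i + r.+3 - 1)%N by lia.
by ring.
Qed.

(** * Solving the recurrences by truncated generating functions *)

Section Cubic.
Variables (x y : nat -> nat) (M : nat).
Hypothesis x0 : x 0 = 1%N.
Hypothesis xS : forall m, (m < M)%N ->
  x m.+1 = (\sum_(0 <= i < m.+1) y i * x (m - i))%N.
Hypothesis yE : forall m, (m < M)%N ->
  (y m + (m == 0) = 2 * \sum_(0 <= i < m.+1) x i * x (m - i))%N.

(** Only coefficients up to [M] matter, so polynomials stand in for power series, and identities are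
    taken modulo powers of ['X] through [eqmod]. *)
Let P : {poly rat} := \poly_(i < M.+1) (x i)%:R.
Let Q : {poly rat} := \poly_(i < M.+1) (y i)%:R.

Let coefP i : (i <= M)%N -> P`_i = (x i)%:R.
Proof. by rewrite coef_poly ltnS => ->. Qed.

Let coefQ i : (i <= M)%N -> Q`_i = (y i)%:R.
Proof. by rewrite coef_poly ltnS => ->. Qed.

Let eqmod (K : nat) (p q : {poly rat}) := forall i, (i < K)%N -> p`_i = q`_i.

Let eqmod_mul K p q r : eqmod K p q -> eqmod K (p * r) (q * r).
Proof.
move=> pq i iK; rewrite !coefM; apply: eq_bigr => j _.
by rewrite pq // (leq_trans _ iK).
Qed.

Let Q_eq : eqmod M (Q + 1) (2%:P * (P * P)).
Proof.
move=> i iM; rewrite coefD coefCM coef1 coefQ 1?ltnW // coefM -natrD yE //.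
rewrite natrM natr_sum big_mkord; congr (_ * _); apply: eq_bigr => j _.
have ji : (j <= i)%N by rewrite -ltnS.
by rewrite natrM !coefP //; lia.
Qed.

Let P_eq : eqmod M.+1 P (1 + 'X * (Q * P)).
Proof.
move=> [|i] iM; rewrite coefP // coefD coef1 coefXM /=; first by rewrite x0 addr0.
rewrite add0r coefM xS // natr_sum big_mkord; apply: eq_bigr => j _.
have ji : (j <= i)%N by rewrite -ltnS.
by rewrite natrM coefP ?coefQ //; lia.
Qed.

(** Eliminate [Q]: [P + X P = 1 + X (Q + 1) P], and [Q + 1] is [2 P ^ 2]. The latter is known only
    modulo [X ^ M]; the factor [X] restores the missing order. *)
Let P_cubic : eqmod M.+1 (P * (1 + 'X)) (1 + 'X * (2%:P * P ^+ 3)).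
Proof.
have h : eqmod M (Q * P + P) (2%:P * P ^+ 3).
  have := eqmod_mul P Q_eq; rewrite mulrDl mul1r -!mulrA => h i /h ->.
  by rewrite !exprS expr0 mulr1.
move=> i iM; rewrite mulrDr mulr1 coefD coefMX [in RHS]coefD coef1 coefXM.
rewrite P_eq // coefD coef1 coefXM -addrA; congr (_ + _).
by case: i iM => [|i] iM /=; rewrite ?addr0 // -h ?coefD.
Qed.

(** Induction on [n], then on [r]: the coefficient of index [n + 1] in [P ^ (r + 1)] follows from
    that in [P ^ r] and from coefficients of index [n] in the powers [r + 1] and [r + 3]. The outer
    hypothesis must therefore cover all powers. *)
Let coef_expr r n : (n <= M)%N -> (P ^+ r)`_n = gnc_coef r n.
Proof.
have rec r' :
    eqmod M.+1 (P ^+ r'.+1 * (1 + 'X)) (P ^+ r' + 'X * (2%:P * P ^+ r'.+3)).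
  move=> i /(eqmod_mul (P ^+ r') P_cubic).
  have -> : P ^+ r' + 'X * (2%:P * P ^+ r'.+3) =
      (1 + 'X * (2%:P * P ^+ 3)) * P ^+ r' by rewrite !exprS; ring.
  by rewrite mulrAC -exprS.
elim: n r => [|n IHn] r nM.
  rewrite gnc_coef_n0; elim: r => [|r IHr]; first by rewrite coef1.
  have := rec r 0%N isT; rewrite mulrDr mulr1 !coefD coefMX coefXM /= !addr0.
  by rewrite IHr.
elim: r => [|r IHr]; first by rewrite coef1 gnc_coef_0S.
have := rec r n.+1 nM; rewrite mulrDr mulr1 !coefD coefMX coefXM /= coefCM.
rewrite !IHn ?(ltnW nM) // IHr -gnc_coef_rec; exact: addIr.
Qed.

Lemma cubic_coef : (x M)%:R =
  \sum_(0 <= i < M.+1)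
     (-1) ^+ (M - i) * (2 ^+ i / (2 * i + 1)%:R) *
     ('C(3 * i, i))%:R * ('C(M + 2 * i, 3 * i))%:R :> rat.
Proof.
rewrite -coefP // -[P]expr1 coef_expr //; apply: eq_big_nat => i /andP[_ iM].
rewrite ternary1.
have -> : (M + 2 * i + 1 - 1 = M + 2 * i)%N by lia.
have -> : 'C(M + 2 * i, 3 * i) = 'C(M + 2 * i, M - i).
  by rewrite -bin_sub; [congr 'C(_, _) | ]; lia.
by ring.
Qed.
End Cubic.

Lemma card_rtree_formula (n : nat) : (#|rtree n 0%N n|)%:R =
  \sum_(0 <= i < n.+1)
     (-1) ^+ (n - i) * (2 ^+ i / (2 * i + 1)%:R) *
     ('C(3 * i, i))%:R * ('C(n + 2 * i, 3 * i))%:R :> rat.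
Proof.
(* The second sequence is shifted: index [d] stands for the edge from 0 to [d.+1], which accounts
   for the factor ['X] in [P_eq]. *)
apply: (@cubic_coef (fun d => #|rtree n 0%N d|)
  (fun d => #|rtree_edge (inord 0%N : 'I_n.+1) (inord d.+1)|)).
- exact: (card_rtree1 (ord0 : 'I_n.+1)).
- move=> m mn; have := @card_rtree_nat n 0%N m; rewrite add0n => -> //.
  apply: eq_big_nat => i /andP[_ im]; rewrite add0n; congr (_ * _)%N.
  by rewrite -(@card_rtree_shift n (m - i)%N i.+1) ?addSn ?subnKC.
- move=> m mn; have := @card_edge_nat n 0%N m; rewrite add0n => -> //.
  congr (2 * _)%N; apply: eq_big_nat => i /andP[_ im]; rewrite add0n; congr (_ * _)%N.
  by rewrite -(@card_rtree_shift n (m - i)%N i.+1) ?addSn ?subnKC.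
Qed.

Theorem theorem2p2 (n : nat) :
  (#|GNC_avoiding n (pred1 [:: Level])|)%:R =
  \sum_(0 <= i < n.+1)
     (-1) ^+ (n - i) * (2 ^+ i / (2 * i + 1)%:R) *
     ('C(3 * i, i))%:R * ('C(n + 2 * i, 3 * i))%:R :> rat.
Proof. by rewrite card_GNC_level card_rtree_formula. Qed.
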